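(* Let $(S,\pi)$ be a proper simplex bundle and $\sigma$ a simple flow such that $(S,\pi)$ is isomorphic to the KMS bundle $(S^\sigma,\pi^\sigma)$ of $\sigma$. Set $S_+:=\pi^{-1}([0,\infty))$ and $S_-:=\pi^{-1}((-\infty,0])$. Then there are continuous surjective maps $\chi_+:\partial S_+\to\mathrm{KMS}_\infty(\sigma)$ and $\chi_-:\partial S_-\to\mathrm{KMS}_{-\infty}(\sigma)$.
   Context: For a locally compact Hausdorff space $X$, $\partial X:=\beta X\setminus X$ is its Stone-Čech boundary (remainder), where $\beta X$ is the Stone-Čech compactification. A flow $\sigma=(\sigma_t)_{t\in\mathbb R}$ on a $C^*$-algebra $A$ is a strongly (pointwise norm) continuous one-parameter group of $*$-automorphisms. A simple flow is a flow $\sigma$ on a unital separable $C^*$-algebra $A$ which is non-trivial (not $\sigma_t=\mathrm{id}_A$ for all $t$) and such that the only closed two-sided $\sigma$-invariant ideals of $A$ are $\{0\}$ and $A$. $\mathcal A_\sigma$ is the dense $*$-algebra of elements $a$ analytic for $\sigma$ ($t\mapsto\sigma_t(a)$ extends to an entire function $z\mapsto\sigma_z(a)$). For $\beta\in\mathbb R$, a state $\omega$ is a $\beta$-KMS state if it is $\sigma$-invariant and $\omega(ab)=\omega(b\sigma_{i\beta}(a))$ for all $b\in A$, $a\in\mathcal A_\sigma$; $S^\sigma_\beta$ is the (possibly empty) simplex of $\beta$-KMS states. $\mathrm{KMS}_\infty(\sigma):=\bigcap_{R>0}\overline{\bigcup_{\beta\ge R}S^\sigma_\beta}$ and $\mathrm{KMS}_{-\infty}(\sigma):=\bigcap_{R<0}\overline{\bigcup_{\beta\le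 R}S^\sigma_\beta}$ (weak* closures in the state space), with the weak* topology. Simplex bundles: Let $S$ be a second countable locally compact Hausdorff space and $\pi:S\to\mathbb R$ continuous (not necessarily surjective). $(S,\pi)$ is a simplex bundle if each fibre $\pi^{-1}(t)$ with the relative topology is homeomorphic to a compact Choquet simplex (and is regarded as such, with its affine structure; the empty set is allowed). $\mathcal A(S,\pi)$ is the set of continuous $f:S\to\mathbb R$ affine on each fibre. $(S,\pi)$ is proper if $\pi^{-1}(K)$ is compact for every compact $K\subseteq\mathbb R$ and $\mathcal A(S,\pi)$ separates points of $S$. An isomorphism of proper simplex bundles $(S,\pi)\to(S',\pi')$ is a homeomorphism $\phi:S\to S'$ with $\pi'\circ\phi=\pi$ that is affine on each fibre. The KMS bundle of $\sigma$ is $(S^\sigma,\pi^\sigma)$ with $S^\sigma=\{(\omega,\beta)\in E(A)\times\mathbb R:\omega\in S^\sigma_\beta\}$ ($E(A)$ the state space with the weak* topology; $S^\sigma$ has the topology inherited from the product) and $\pi^\sigma(\omega,\beta)=\beta$. *)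

(* Defs.v *)
From HB Require Import structures.
From mathcomp Require Import all_boot all_order all_algebra.
From mathcomp Require Import complex.
From mathcomp Require Import all_classical all_reals all_analysis.
Set Implicit Arguments.
Unset Strict Implicit.
Unset Printing Implicit Defensive.
Import Order.TTheory GRing.Theory Num.Theory.
Import numFieldNormedType.Exports.
Local Open Scope classical_set_scope.
Local Open Scope ring_scope.
Local Open Scope complex_scope.

Definition homeomorphism (X Y : topologicalType) (f : X -> Y) : Prop :=
  continuous f /\
  exists g : Y -> X, [/\ cancel f g, cancel g f & continuous g].

(** The Stone-Cech compactification of X is Tychonoff's: the closure of the
    image of X in the cube [0, 1]^C(X, [0, 1]). The cube is compact, hence
    closed in the product of copies of R in which the closure is taken. *)

Definition cube_coord (R : realType) (X : topologicalType) : set (X -> R) :=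
  [set f : X -> R | continuous f /\ forall x, 0 <= f x <= 1].
Arguments cube_coord R X _ : clear implicits.

Definition cube_emb (R : realType) (X : topologicalType) (x : X) :
  {ptws cube_coord R X -> R} := fun f => \val f x.

Definition stone_cech (R : realType) (X : topologicalType) : topologicalType :=
  set_type (closure (range (@cube_emb R X))).

Definition boundary (R : realType) (X : topologicalType) :
    set (stone_cech R X) :=
  [set y | ~ range (@cube_emb R X) (\val y)].
Arguments boundary R X _ : clear implicits.

(** The product is a field of the mixin: the library has no structure joining
    [normedModType] and [algType], and one cannot be added after
    [numDomainType]. The algebra may be zero. *)
HB.mixin Record isCStarAlgebra (R : realType) A
    of CompleteNormedModule R[i] A := {
  cmul : A -> A -> A;
  cone : A;
  star : A -> A;
  cmulA : associative cmul;
  cmul1l : left_id cone cmul;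
  cmul1r : right_id cone cmul;
  cmulDl : left_distributive cmul +%R;
  cmulDr : right_distributive cmul +%R;
  cmulZl : forall (c : R[i]) (a b : A), cmul (c *: a) b = c *: cmul a b;
  cmulZr : forall (c : R[i]) (a b : A), cmul a (c *: b) = c *: cmul a b;
  norm_cmul_le : forall a b : A, `|cmul a b| <= `|a| * `|b|;
  starK : involutive star;
  starD : forall a b : A, star (a + b) = star a + star b;
  starZ : forall (c : R[i]) (a : A), star (c *: a) = c^* *: star a;
  star_cmul : forall a b : A, star (cmul a b) = cmul (star b) (star a);
  norm_star_cmul : forall a : A, `|cmul (star a) a| = `|a| ^+ 2
}.

#[short(type="cstarAlgType")]
HB.structure Definition CStarAlgebra (R : realType) :=
  {A of isCStarAlgebra R A & CompleteNormedModule R[i] A}.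

Section CStar.
Context (R : realType) (A : cstarAlgType R).
Implicit Types (sigma : R -> A -> A) (a b : A).

Local Notation "a ** b" := (cmul a b) (at level 40, left associativity).

Definition separable : Prop :=
  exists2 D : set A, countable D & dense D.

Definition star_automorphism (f : A -> A) : Prop :=
  [/\ linear f,
      forall a b, f (a ** b) = f a ** f b,
      forall a, f (star a) = star (f a) &
      bijective f].

Definition flow sigma : Prop :=
  [/\ forall t, star_automorphism (sigma t),
      sigma 0 = id,
      forall s t a, sigma (s + t) a = sigma s (sigma t a) &
      forall a, continuous (fun t : R => sigma t a)].

Definition closed_ideal (I : set A) : Prop :=
  [/\ closed I,
      I 0,
      forall (c : R[i]) a b, I a -> I b -> I (c *: a + b),
      forall a b, I b -> I (a ** b) &
      forall a b, I a -> I (a ** b)].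

Definition simple_flow sigma : Prop :=
  [/\ flow sigma,
      separable,
      ~ (forall t a, sigma t a = a) &
      forall I : set A, closed_ideal I ->
        (forall t a, I a -> I (sigma t a)) -> I = [set 0] \/ I = setT].

(** [F z] is sigma_z(a); a is analytic for sigma when such an F exists, and F
    is then unique by the identity theorem. *)
Definition analytic_extension sigma a (F : R[i]^o -> A) : Prop :=
  (forall z, derivable F z 1) /\ (forall t : R, F t%:C = sigma t a).

Definition is_state (w : A -> R[i]) : Prop :=
  [/\ scalar w,
      forall a, 0 <= w (star a ** a) &
      supremums [set `|w a| | a in [set a : A | `|a| <= 1]] 1].

(** The weak* topology is the topology of pointwise convergence on A. *)
Definition state_space : topologicalType :=
  set_type [set w : {ptws A -> R[i]^o} | is_state w].

Definition state_eval (w : state_space) : A -> R[i] := \val w.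

Definition KMS sigma (beta : R) : set state_space :=
  [set w | (forall t a, state_eval w (sigma t a) = state_eval w a) /\
     forall a b F, analytic_extension sigma a F ->
       state_eval w (a ** b) = state_eval w (b ** F (0 +i* beta))].

Definition KMS_pinfty sigma : set state_space :=
  \bigcap_(r in [set r : R | 0 < r])
    closure (\bigcup_(beta in [set beta : R | r <= beta]) KMS sigma beta).

Definition KMS_ninfty sigma : set state_space :=
  \bigcap_(r in [set r : R | r < 0])
    closure (\bigcup_(beta in [set beta : R | beta <= r]) KMS sigma beta).

End CStar.

Section Simplex.
Context (R : realType) (V : tvsType R).

Definition cone_over (K : set V) : set (V * R^o) :=
  [set p | exists2 l : R, 0 <= l & exists2 x, K x & p = (l *: x, l)].

Definition cone_span (K : set V) : set (V * R^o) :=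
  [set p | exists u v, [/\ cone_over K u, cone_over K v & p = u - v]].

(** K, placed at height 1 in V x R, is the base of the cone P = [cone_over K].
    K is a simplex when P - P, ordered by P, is a vector lattice; infima come
    from suprema by u /\ v = - ((- u) \/ (- v)). *)
Definition choquet_simplex (K : set V) : Prop :=
  convex_set K /\
  forall u v, cone_span K u -> cone_span K v ->
    exists w, [/\ cone_span K w, cone_over K (w - u), cone_over K (w - v) &
      forall w', cone_span K w' -> cone_over K (w' - u) ->
        cone_over K (w' - v) -> cone_over K (w' - w)].

End Simplex.

(** [bcomb l x y z] says that z is the convex combination l x + (1 - l) y;
    it is only used for 0 <= l <= 1 and x, y, z in the same fibre. *)
Record bundle (R : realType) := Bundle {
  btotal :> topologicalType;
  bproj : btotal -> R;
  bcomb : R -> btotal -> btotal -> btotal -> Prop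
}.

Definition fibre (R : realType) (S : bundle R) (t : R) : set S :=
  @bproj R S @^-1` [set t].
Arguments fibre {R} S t _ : simpl never.

Definition simplex_fibre (R : realType) (S : bundle R) (t : R) : Prop :=
  exists (V : tvsType R) (K : set V) (h : fibre S t -> K),
    [/\ hausdorff_space V, compact K, choquet_simplex K, homeomorphism h &
      forall (l : R) (x y z : fibre S t), 0 <= l <= 1 ->
        bcomb l (\val x) (\val y) (\val z) <->
        \val (h z) = l *: \val (h x) + (1 - l) *: \val (h y)].

Definition simplex_bundle (R : realType) (S : bundle R) : Prop :=
  [/\ @second_countable S, locally_compact [set: S], hausdorff_space S,
      continuous (@bproj R S) & forall t, simplex_fibre S t].

Definition affine_functions (R : realType) (S : bundle R) : set (S -> R) :=
  [set f | continuous f /\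
     forall t (l : R) x y z, fibre S t x -> fibre S t y -> fibre S t z ->
       0 <= l <= 1 -> bcomb l x y z -> f z = l * f x + (1 - l) * f y].
Arguments affine_functions {R} S _.

Definition proper_simplex_bundle (R : realType) (S : bundle R) : Prop :=
  [/\ simplex_bundle S,
      forall K : set R, compact K -> compact (@bproj R S @^-1` K) &
      forall x y : S, x <> y ->
        exists2 f, affine_functions S f & f x <> f y].

Definition bundle_isomorphic (R : realType) (S S' : bundle R) : Prop :=
  exists phi : S -> S',
    [/\ homeomorphism phi,
        forall x, bproj (phi x) = bproj x &
        forall t (l : R) x y z, fibre S t x -> fibre S t y -> fibre S t z ->
          0 <= l <= 1 -> bcomb l x y z ->
          bcomb l (phi x) (phi y) (phi z)].

Definition plus_part (R : realType) (S : bundle R) : set S :=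
  [set x | 0 <= bproj x].
Definition minus_part (R : realType) (S : bundle R) : set S :=
  [set x | bproj x <= 0].
Arguments plus_part {R} S _.
Arguments minus_part {R} S _.

Definition kms_total (R : realType) (A : cstarAlgType R) (sigma : R -> A -> A) :
    set (state_space A * R) :=
  [set p | KMS sigma p.2 p.1].

Definition kms_bundle (R : realType) (A : cstarAlgType R)
    (sigma : R -> A -> A) : bundle R :=
  @Bundle R (kms_total sigma : topologicalType) (fun p => (\val p).2)
    (fun l p q r => forall a : A,
       state_eval (\val r).1 a =
       l%:C * state_eval (\val p).1 a + (1 - l)%:C * state_eval (\val q).1 a).

(* Main.v *)
Require Import Defs.
From mathcomp Require Import all_boot all_order all_algebra.
From mathcomp Require Import complex.
From mathcomp Require Import ring lra.
From mathcomp Require Import all_classical all_reals all_analysis.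
Set Implicit Arguments.
Unset Strict Implicit.
Unset Printing Implicit Defensive.
Import Order.TTheory GRing.Theory Num.Theory.
Import numFieldNormedType.Exports.
Local Open Scope classical_set_scope.
Local Open Scope ring_scope.
(** The states given by p : X -> E(A) are bounded coordinatewise, |p x a| <= |a|,
    so p extends to the Stone-Cech compactification coordinate by coordinate,
    and the values stay states because being a state is a closed condition.
    If q : X -> R is continuous with compact sublevel sets, then the boundary is
    the intersection of the closures of the sets {q >= r} in beta X, and its
    image under the extension is, by compactness, the intersection of the
    closures of p({q >= r}).  For X = S_+ and q = pi (resp. X = S_- and
    q = - pi) this is KMS_infty (resp. KMS_-infty). *)

(** * Products and subspaces *)

Lemma continuous_ptws (T : topologicalType) (I : eqType) (V : topologicalType)
    (f : T -> {ptws I -> V}) :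
  (forall i, continuous (fun x => f x i)) -> continuous f.
Proof.
move=> cf x; apply/cvg_sup => i.
apply: (@continuous_comp_initial _ T _ (fun g : {ptws I -> V} => g i)).
exact: cf.
Qed.

Lemma continuous_set_val (T : topologicalType) (B : set T) :
  continuous (\val : B -> T).
Proof. exact: initial_continuous. Qed.

Lemma continuous_to_set_type (T U : topologicalType) (B : set U)
    (f : T -> B) :
  continuous (fun x => \val (f x)) -> continuous f.
Proof. exact: continuous_comp_initial. Qed.

(** A filter on [C] pushed forward along [\val] clusters at some point of the image; open sets of
    [B] are traces of open sets of [T], so the cluster point lifts to [C]. *)
Lemma compact_set_type (T : topologicalType) (B : set T) (C : set B) :
  compact (\val @` C) -> compact C.
Proof.
move=> cC F FF FC.
have [|_ [[c Cc <-] clc]] := cC (fmap \val F) (fmap_proper_filter _ FF).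
  by apply: (@filterS _ F _ C) => // c Cc; exists c.
exists c; split=> // A N FA [V [[W oW <-] Wc] VN].
have [||_ [[a Aa <-] Wa]] := clc (\val @` A) W.
- by apply: (@filterS _ F _ A) => // a Aa; exists a.
- exact: open_nbhs_nbhs.
by exists a; split=> //; apply: VN.
Qed.

Lemma hausdorff_set_type (T : topologicalType) (B : set T) :
  hausdorff_space T -> hausdorff_space B.
Proof.
move=> hT x y clxy; apply/val_inj/hT => U V Ux Vy.
have [||z [Uz Vz]] := clxy (\val @^-1` U) (\val @^-1` V).
- exact: continuous_set_val.
- exact: continuous_set_val.
by exists (\val z).
Qed.

(** * Real and imaginary parts *)

Lemma continuous_Re (R : realType) : continuous (fun z : R[i]^o => complex.Re z : R).
Proof.
move=> x U [e /= e0 eU]; exists e%:C%C; first by rewrite /= ltcR.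
move=> y /= xy; apply: eU; rewrite /= -ltcR; apply: le_lt_trans xy.
by rewrite -raddfB; exact: normc_ge_Re.
Qed.

Lemma continuous_Im (R : realType) : continuous (fun z : R[i]^o => complex.Im z : R).
Proof.
have -> : (fun z : R[i]^o => complex.Im z : R) = fun z => complex.Re (- 'i%C * z).
  by apply/funext => -[x y] /=; rewrite oppr0 mul0r mulN1r opprK add0r.
move=> x; apply: (@continuous_comp R[i]^o R[i]^o R (fun z => - 'i%C * z)
  (fun z => complex.Re z)).
  exact: mulrl_continuous.
exact: continuous_Re.
Qed.

Lemma continuous_complex (R : realType) (T : topologicalType) (f g : T -> R) :
  continuous f -> continuous g -> continuous (fun x => (f x +i* g x)%C : R[i]^o).
Proof.
have cC : continuous (fun r : R => r%:C%C : R[i]^o).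
  (* The radius [e] is a positive element of [R[i]], hence real, and its real part is a radius in
     [R]. *)
  move=> x U [e /=]; rewrite ltcE => /andP[/eqP/= Ie Re0 eU].
  exists (complex.Re e) => // y /= xy; apply: eU => /=.
  rewrite -rmorphB normc_def /= expr0n addr0 sqrtr_sqr.
  by rewrite ltcE /= Ie eqxx.
move=> cf cg.
have -> : (fun x => (f x +i* g x)%C : R[i]^o) =
    fun x => (f x)%:C%C + 'i%C * (g x)%:C%C.
  by apply/funext => x; rewrite [LHS]complexE.
move=> x; apply: (@cvgD _ R[i]^o).
  by apply: continuous_comp; [exact: cf|exact: cC].
apply: (@continuous_comp T R[i]^o R[i]^o (fun x => (g x)%:C%C) (fun z => 'i%C * z)).
  by apply: continuous_comp; [exact: cg|exact: cC].
exact: mulrl_continuous.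
Qed.

(** * The Stone-Čech compactification and its boundary *)

Section stone_cech.
Context (R : realType) (X : topologicalType).
Local Notation cube := {ptws cube_coord R X -> R}.

Lemma continuous_cube_emb : continuous (@cube_emb R X).
Proof.
by apply: continuous_ptws => -[f fX]; case: (set_mem fX).
Qed.

Definition stone_cech_emb (x : X) : stone_cech R X :=
  SigSub (mem_set (subset_closure (imageT (@cube_emb R X) x))).

Lemma continuous_stone_cech_emb : continuous stone_cech_emb.
Proof. by apply: continuous_to_set_type; exact: continuous_cube_emb. Qed.

(** Density principle: by construction every point of βX is a limit of points of X in the cube, so
    closed conditions pass from X to βX. *)
Lemma closed_stone_cech (D : set cube) : closed D ->
  (forall x, D (cube_emb x)) -> forall y : stone_cech R X, D (\val y).
Proof.
move=> cD DX y; rewrite (closure_id D).1//.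
by apply: closureS (set_valP y) => _ [x _ <-].
Qed.

Lemma dense_stone_cech : closure (range stone_cech_emb) = setT.
Proof.
rewrite -subTset => y _ N [V [[W oW <-] Wy] VN].
have [_ [[x _ <-] Wx]] := set_valP y _ (open_nbhs_nbhs (conj oW Wy)).
by exists (stone_cech_emb x); split; [exists x|exact: VN].
Qed.

Lemma hausdorff_stone_cech : hausdorff_space (stone_cech R X).
Proof.
apply: hausdorff_set_type; apply: hausdorff_product => _; exact: Rhausdorff.
Qed.

Lemma compact_stone_cech : compact [set: stone_cech R X].
Proof.
apply: compact_set_type.
have cK := tychonoff (fun _ : cube_coord R X => @segment_compact R 0 1).
apply: (subclosed_compact _ cK).
  have -> : \val @` [set: stone_cech R X] = closure (range (@cube_emb R X)).
    apply/seteqP; split => [_ [y _ <-]|y yX]; first exact: set_valP.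
    by exists (SigSub (mem_set yX)).
  exact: closed_closure.
move=> _ [y _ <-]; apply: (closed_stone_cech (compact_closed _ cK)) => [|x [f fX]].
  by apply: hausdorff_product => _; exact: Rhausdorff.
by case: (set_mem fX) => _ /(_ x); rewrite /= in_itv.
Qed.

(** After an affine rescaling into [0, 1], [g] is itself one of the coordinates of the cube; undoing
    the rescaling on that coordinate extends [g]. *)
Lemma cube_extension (g : X -> R) (M : R) :
    continuous g -> (forall x, `|g x| <= M) ->
  exists2 G : cube -> R, continuous G & forall x, G (cube_emb x) = g x.
Proof.
(* [N] is positive whatever the sign of [M], which may be negative when X is empty, and it still
   bounds |g|. *)
move=> cg gM; pose N := `|M| + 1.
have N0 : 0 < N by rewrite ltr_wpDl.
pose h x := (g x / N + 1) / 2.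
have hX : cube_coord R X h.
  split=> [x|x].
    apply: cvgM; last exact: cvg_cst.
    apply: cvgD; last exact: cvg_cst.
    by apply: cvgM; [exact: cg|exact: cvg_cst].
  have : `|g x / N| <= 1.
    rewrite normrM normfV (gtr0_norm N0) ler_pdivrMr// mul1r.
    by rewrite (le_trans (gM x))// (le_trans (ler_norm M))// lerDl.
  rewrite ler_norml /h => /andP[? ?]; lra.
pose i : cube_coord R X := SigSub (mem_set hX).
exists (fun y : cube => N * (2 * y i - 1)) => [y|x].
  apply: (@continuous_comp cube R R (fun y => y i) (fun r => N * (2 * r - 1))).
    exact: proj_continuous.
  apply: cvgM; first exact: cvg_cst.
  apply: cvgB; last exact: cvg_cst.
  by apply: cvgM; [exact: cvg_cst|exact: cvg_id].
rewrite /cube_emb /= /h; field.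
by rewrite gt_eqF.
Qed.

Lemma complex_cube_extension (g : X -> R[i]^o) (M : R) :
    continuous g -> (forall x, `|g x| <= M%:C%C) ->
  exists2 G : cube -> R[i]^o, continuous G & forall x, G (cube_emb x) = g x.
Proof.
move=> cg gM.
have [x|x|G1 cG1 G1E] := @cube_extension (fun x => complex.Re (g x)) M.
- by apply: continuous_comp; [exact: cg|exact: continuous_Re].
- by rewrite -lecR; apply: le_trans (normc_ge_Re _) (gM x).
have [x|x|G2 cG2 G2E] := @cube_extension (fun x => complex.Im (g x)) M.
- by apply: continuous_comp; [exact: cg|exact: continuous_Im].
- move: (gM x); rewrite normc_def lecR; apply: le_trans.
  by rewrite -sqrtr_sqr ler_wsqrtr// lerDr sqr_ge0.
exists (fun y => (G1 y +i* G2 y)%C); first exact: continuous_complex.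
by move=> x; rewrite G1E G2E; case: (g x).
Qed.

Lemma boundary_image (Y : topologicalType) (P : stone_cech R X -> Y)
    (q : X -> R) :
    hausdorff_space Y -> continuous P -> continuous q ->
    (forall r, compact [set x | q x <= r]) ->
  P @` boundary R X =
  \bigcap_(r in [set r : R | 0 < r])
     closure ((P \o stone_cech_emb) @` [set x | r <= q x]).
Proof.
move=> hY cP cq qK; apply/seteqP; split=> [_ [y yX <-] r /= r0|w wP].
  (* X is the union of {q <= r} and {q >= r}. The image of the first is compact, hence closed in βX,
     so it contains no boundary point; [y] must be a limit of the second. *)
  have ycl : closure (stone_cech_emb @` [set x | r <= q x]) y.
    have : closure (range stone_cech_emb) y by rewrite dense_stone_cech.
    have -> : range stone_cech_emb = stone_cech_emb @` [set x | q x <= r] `|`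
        stone_cech_emb @` [set x | r <= q x].
      rewrite -image_setU; congr (_ @` _); apply/esym; rewrite -subTset => x _ /=.
      by case: (leP (q x) r) => [|/ltW]; [left|right].
    rewrite closureU => -[|//].
    have cK : compact (stone_cech_emb @` [set x | q x <= r]).
      apply: continuous_compact (qK r).
      exact/continuous_subspaceT/continuous_stone_cech_emb.
    move/closure_id : (compact_closed hausdorff_stone_cech cK) => <-.
    by case=> x _ xy; case: yX; exists x => //; rewrite -xy.
  move=> N /cP /ycl [_ [[x xr <-] Nx]].
  by exists (P (stone_cech_emb x)); split=> //; exists x.
(* A cluster point in beta X of the filter on X generated by the sets
   {q >= r} and (P o emb)^-1(N), for N a neighbourhood of w, is a preimage of w
   in the boundary. *)
pose D := [set i : R * set Y | 0 < i.1 /\ nbhs w i.2].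
pose B (i : R * set Y) :=
  [set x | i.1 <= q x /\ i.2 (P (stone_cech_emb x))].
pose F := filter_from D B.
have FF : ProperFilter F.
  apply: filter_from_proper.
    apply: filter_from_filter.
      by exists (1, setT); split=> //=; exact: filterT.
    move=> [r U] [s V] [/= r0 wU] [/= s0 wV].
    exists (Num.max r s, U `&` V); first split=> /=.
    - by rewrite lt_max r0.
    - exact: filterI.
    by move=> x [/=]; rewrite ge_max => /andP[rx sx] [Ux Vx]; split.
  move=> [r U] [/= r0 wU].
  have [_ [[x xr <-] Ux]] := wP r r0 U wU.
  by exists x; split.
have [//|y [_ Fy]] := compact_stone_cech (fmap_proper_filter stone_cech_emb FF).
  exact: filterT.
have yr r : 0 < r -> closure (stone_cech_emb @` [set x | r <= q x]) y.
  move=> r0 N yN.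
  have [||z [zr Nz]] := Fy (stone_cech_emb @` [set x | r <= q x]) N => //.
    by exists (r, setT); [split=> //; exact: filterT|move=> x [/= rx _]; exists x].
  by exists z.
exists y.
  move=> [x0 _ yx0].
  (* This coordinate vanishes at x0 but is 1 on {q >= |q x0| + 1}. *)
  pose g x := Num.min 1 (Num.max 0 (q x - q x0)).
  have gX : cube_coord R X g.
    split=> [x|x].
      apply: (@continuous_min R X (cst 1)); first exact: cvg_cst.
      apply: (@continuous_max R X (cst 0)); first exact: cvg_cst.
      by apply: cvgB; [exact: cq|exact: cvg_cst].
    by rewrite /g le_min ler01 /= le_max lexx /= ge_min lexx.
  pose i : cube_coord R X := SigSub (mem_set gX).
  have yi0 : \val y i = 0.
    by rewrite -yx0 /cube_emb /= /g subrr maxxx min_r.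
  have : closed [set z : stone_cech R X | 1 <= \val z i].
    apply: (@closed_comp _ _ (fun z : stone_cech R X => \val z i) [set r | 1 <= r]);
      last exact: closed_ge.
    move=> z _; apply: (@continuous_comp (stone_cech R X) cube R \val (fun f => f i)).
      exact: continuous_set_val.
    exact: proj_continuous.
  move/closure_id => cl1.
  have : [set z : stone_cech R X | 1 <= \val z i] y.
    rewrite cl1; apply: closureS (yr (`|q x0| + 1) _); last by rewrite ltr_wpDl.
    move=> _ [x /= xr <-] /=.
    rewrite /cube_emb /= /g le_min lexx /= le_max; apply/orP; right.
    by rewrite lerBrDl (le_trans _ xr)// lerD2r ler_norm.
  by rewrite /= yi0 ler10.
(* P(y) = w because neighbourhoods of the two always meet: [y] clusters along a filter whose image
   under P ∘ emb converges to [w]. *)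
apply: hY => U V yU wV.
have [|z [[x [_ Vx] <-] Ux]] := Fy (stone_cech_emb @` B (1, V)) _ _ (cP _ _ yU).
  by exists (1, V) => // x Bx; exists x.
by exists (P (stone_cech_emb x)).
Qed.

End stone_cech.

Lemma image_onto (T U : topologicalType) (f : T -> U) (B : set T) (C : set U) :
    continuous f -> f @` B = C ->
  exists chi : B -> C, continuous chi /\ range chi = setT.
Proof.
move=> cf fBC.
have fC (x : B) : f (\val x) \in C.
  by rewrite -fBC inE; exists (\val x) => //; exact: set_valP.
exists (fun x => SigSub (fC x)); split.
  apply: continuous_to_set_type => x.
  by apply: continuous_comp; [exact: continuous_set_val|exact: cf].
rewrite -subTset => y _; have := set_valP y; rewrite -{1}fBC => -[x Bx xy].
by exists (SigSub (mem_set Bx)) => //; exact/val_inj.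
Qed.

(** * States as a set of functionals closed under pointwise limits *)

Section states.
Context (R : realType) (A : cstarAlgType R).
Implicit Types (w : A -> R[i]) (a b : A).
Local Notation "a ** b" := (cmul a b) (at level 40, left associativity).
Local Notation one := (cone : A).

Lemma star_one : star one = one.
Proof.
by rewrite -[RHS]starK -[in RHS](cmul1r (star one)) star_cmul starK cmul1r.
Qed.

(** The C*-identity gives |1| = |1|^2. Equality with 1 would fail in the zero algebra. *)
Lemma norm_one_le1 : `|one| <= 1.
Proof.
have := norm_star_cmul one; rewrite star_one cmul1l => n1.
rewrite (real_leNgt (normr_real _) (@real1 _)); apply/negP => lt1.
by have := lt1; rewrite -(ltr_pMr _ (lt_trans ltr01 lt1)) -expr2 -n1 ltxx.
Qed.

Lemma state_norm_le w a : is_state w -> `|w a| <= `|a|.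
Proof.
move=> [wlin _ [wub _]].
have w0 : w 0 = 0.
  have := wlin 1 0 0; rewrite scaler0 add0r mul1r => /esym/eqP.
  by rewrite -subr_eq0 addrK => /eqP.
have [->|a0] := eqVneq a 0; first by rewrite w0 !normr0.
(* The bound on the unit ball is applied to a/|a|; the summand 0 gives the argument the shape
   required by [scalar]. *)
have /wub : [set `|w b| | b in [set b : A | `|b| <= 1]] `|w (`|a|^-1 *: a + 0)|.
  exists (`|a|^-1 *: a + 0) => //=.
  by rewrite addr0 normrZ normfV normr_id mulVf// normr_eq0.
rewrite wlin w0 addr0 normrM normfV normr_id mulrC.
by rewrite ler_pdivrMr ?normr_gt0// mul1r.
Qed.

Section positive.
Variable w : A -> R[i].
Hypotheses (wlin : scalar w) (wpos : forall a, 0 <= w (star a ** a)).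

Let wD a b : w (a + b) = w a + w b.
Proof. by have := wlin 1 a b; rewrite scale1r mul1r. Qed.

Let wZ c a : w (c *: a) = c * w a.
Proof.
have w0 : w 0 = 0 by apply/eqP; rewrite -(inj_eq (addrI (w 0))) -wD !addr0.
by have := wlin c a 0; rewrite w0 !addr0.
Qed.

Lemma positive_one_ge0 : 0 <= w one.
Proof. by have := wpos one; rewrite star_one cmul1l. Qed.

(** Positivity at c1 + a for well-chosen c yields both the hermitian symmetry of [w] and the
    variance inequality. *)
Lemma positive_translate c a :
  w (star (c *: one + a) ** (c *: one + a)) =
  c^* * c * w one + c^* * w a + c * w (star a) + w (star a ** a).
Proof.
rewrite starD starZ star_one cmulDl !cmulDr !cmulZl !cmulZr !cmul1l cmul1r.
by rewrite !wD !wZ !addrA mulrA.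
Qed.

Lemma positive_star a : w (star a) = (w a)^*.
Proof.
have H c : (c^* * w a + c * w (star a))^* = c^* * w a + c * w (star a).
  apply: conj_Creal.
  have -> : c^* * w a + c * w (star a) =
      w (star (c *: one + a) ** (c *: one + a)) -
        c^* * c * w one - w (star a ** a).
    by rewrite positive_translate; ring.
  rewrite !rpredB// ger0_real// ?wpos//.
  by rewrite mulr_ge0// ?positive_one_ge0// mulrC mul_conjC_ge0.
have := H 1; have := H 'i.
rewrite !rmorphD !rmorphM /= !conjCK conjCi rmorph1 !mul1r.
set x := w a; set y := w (star a) => e1 e2.
have i0 : ('i : R[i]) != 0 by rewrite neq0Ci.
have {}e1 : x^* - y^* = y - x.
  apply: (mulfI i0); rewrite !mulrBr -!mulNr e1; ring.
apply: (@mulfI _ 2) => //.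
have -> : 2 * y = (x + y) + (y - x) by ring.
by rewrite -e2 -e1; ring.
Qed.

(* This is positivity at a - w(a) 1. *)
Lemma positive_variance a : `|w a| ^+ 2 * (2 - w one) <= w (star a ** a).
Proof.
rewrite -subr_ge0 (_ : _ - _ = w (star (- w a *: one + a) ** (- w a *: one + a)))//.
by rewrite positive_translate positive_star normCK rmorphN /=; ring.
Qed.

End positive.

(** Put c = 2 - w(1), which is positive since w(1) <= 1. On the unit ball the variance inequality
    gives c |w(a)|^2 <= w(a* a) <= 1, so the supremum 1 is at most c^(-1/2). Hence c <= 1, that is,
    w(1) >= 1. *)
Lemma state_one w : is_state w -> w one = 1.
Proof.
move=> ws; have [wlin wpos [wub wlub]] := ws.
have w1 : 0 <= w one by exact: positive_one_ge0.
have w1_le1 : w one <= 1.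
  by rewrite -[w one]ger0_norm//; apply: le_trans (state_norm_le _ ws) norm_one_le1.
have c0 : 0 < 2 - w one.
  by rewrite subr_gt0 (le_lt_trans w1_le1)// ltr1n.
apply/le_anti; rewrite w1_le1 /=.
have : 1 <= sqrtC (2 - w one)^-1.
  apply: wlub => _ [a /= a1 <-].
  rewrite -(@ler_pXn2r _ 2)// ?nnegrE ?sqrtC_ge0 ?invr_ge0 ?(ltW c0)// sqrtCK.
  rewrite -[leRHS]mul1r ler_pdivlMr//.
  apply: le_trans (positive_variance wlin wpos a) _.
  rewrite -[leLHS]ger0_norm//; apply: le_trans (state_norm_le _ ws) _.
  by rewrite norm_star_cmul expr_le1.
move=> s1; have : 1 <= (2 - w one)^-1.
  by rewrite -[leRHS]sqrtCK expr_ge1 // ?(le_trans _ s1).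
by rewrite invf_ge1// lerBlDr -lerBlDl; apply: le_trans; rewrite lerBrDr.
Qed.

(* Unlike the supremum in [is_state], these conditions are visibly closed under
   pointwise limits. *)
Lemma is_stateP w : is_state w <->
  [/\ scalar w, forall a, 0 <= w (star a ** a),
      forall a, `|w a| <= `|a| & w one = 1].
Proof.
split=> [ws|[wlin wpos wle w1]].
  have [wlin wpos _] := ws; split=> // [a|]; [exact: state_norm_le|exact: state_one].
split=> //; split=> [_ [a /= a1 <-]|u uub]; first exact: le_trans (wle a) a1.
by apply: uub; exists one; [exact: norm_one_le1|rewrite w1 normr1].
Qed.

End states.

(** * Extension of state-valued maps to βX *)

Lemma closed_ge0C (R : realType) : closed [set z : R[i]^o | 0 <= z].
Proof.
(* In the order of [R[i]], 0 <= z means that z is real with nonnegative real part. *)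
have -> : [set z : R[i]^o | 0 <= z] =
    (fun z => complex.Im z) @^-1` [set 0] `&`
    (fun z => complex.Re z) @^-1` [set r | 0 <= r].
  apply/seteqP; split=> z; rewrite /= lecE /=.
    by move=> /andP[/eqP].
  by move=> [-> ->]; rewrite eqxx.
apply: closedI; apply: closed_comp.
- by move=> z _; exact: continuous_Im.
- exact: closed_eq.
- by move=> z _; exact: continuous_Re.
- exact: closed_ge.
Qed.

(** This presents linearity of a limit functional as the vanishing of a continuous function, a
    closed condition. *)
Lemma continuous_linear_defect (R : realType) (T : topologicalType)
    (c : R[i]) (f g h : T -> R[i]^o) :
  continuous f -> continuous g -> continuous h ->
  continuous (fun x => f x - (c * g x + h x) : R[i]^o).
Proof.
move=> cf cg ch x; apply: (@cvgB _ R[i]^o); first exact: cf.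
apply: (@cvgD _ R[i]^o); last exact: ch.
by apply: (@cvgM R[i]); [exact: cvg_cst|exact: cg].
Qed.

Lemma continuous_norm_defect (R : realType) (T : topologicalType)
    (c : R[i]) (f : T -> R[i]^o) :
  continuous f -> continuous (fun x => c - `|f x| ^+ 2 : R[i]^o).
Proof.
move=> cf x; apply: (@cvgB _ R[i]^o); first exact: cvg_cst.
by apply: (@cvgM R[i]); apply: (@cvg_norm _ R[i]^o); exact: cf.
Qed.

Lemma hausdorff_state_space (R : realType) (A : cstarAlgType R) :
  hausdorff_space (state_space A).
Proof.
apply: hausdorff_set_type; apply: hausdorff_product => _.
exact: norm_hausdorff.
Qed.

Lemma continuous_state_eval (R : realType) (A : cstarAlgType R) (a : A) :
  continuous (fun w : state_space A => state_eval w a : R[i]^o).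
Proof.
move=> w.
apply: (@continuous_comp (state_space A) {ptws A -> R[i]^o} R[i]^o \val
  (fun f => f a)).
  exact: continuous_set_val.
exact: proj_continuous.
Qed.

Lemma stone_cech_extend_state (R : realType) (A : cstarAlgType R)
    (X : topologicalType) (p : X -> state_space A) : continuous p ->
  exists2 P : stone_cech R X -> state_space A, continuous P &
    forall x, P (stone_cech_emb R x) = p x.
Proof.
move=> cp; pose cube := {ptws cube_coord R X -> R}.
have px x := (is_stateP _).1 (set_valP (p x)).
have [W cW WE] : exists2 W : A -> cube -> R[i]^o,
    forall a, continuous (W a) &
    forall a x, W a (cube_emb x) = state_eval (p x) a.
  have /choice[W WP] (a : A) : exists G : cube -> R[i]^o,
      continuous G /\ forall x, G (cube_emb x) = state_eval (p x) a.
    (* The norm of [A] takes values in [R[i]], so the real bound required here is the real part of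
       |a|. *)
    have [x|x|G cG GE] := @complex_cube_extension R X
        (fun x => state_eval (p x) a) (complex.Re `|a|).
    - apply: (@continuous_comp X (state_space A) R[i]^o p
        (fun w => state_eval w a)); [exact: cp|exact: continuous_state_eval].
    - by rewrite RRe_real ?normr_real//; have [_ _ + _] := px x; exact.
    - by exists G.
  by exists W => a; have [] := WP a.
have clW (f : cube -> R[i]^o) (D : set R[i]^o) : continuous f -> closed D ->
    (forall x, D (f (cube_emb x))) -> forall y : stone_cech R X, D (f (\val y)).
  move=> cf cD Df; apply: (@closed_stone_cech R X (f @^-1` D)) => //.
  by apply: closed_comp => // z _; exact: cf.
(* Each clause of [is_stateP] becomes a closed condition on finitely many of the extensions [W a],
   and it holds on X. *)
have WS (y : stone_cech R X) : is_state (fun a => W a (\val y)).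
  apply/is_stateP; split.
  - move=> c a b; apply/eqP; rewrite -subr_eq0; apply/eqP.
    apply: (clW (fun y => W (c *: a + b) y - (c * W a y + W b y)) [set 0]).
    + exact: continuous_linear_defect.
    + exact/accessible_closed_set1/hausdorff_accessible/norm_hausdorff.
    + by move=> x /=; rewrite !WE /state_eval; have [-> _ _ _] := px x; rewrite subrr.
  - move=> a; apply: (clW _ _ (cW _) (@closed_ge0C R)) => x /=.
    by rewrite WE; have [_ + _ _] := px x; exact.
  - move=> a; rewrite -(@ler_pXn2r _ 2)// ?nnegrE// -subr_ge0.
    apply: (clW (fun y => `|a| ^+ 2 - `|W a y| ^+ 2) _ _ (@closed_ge0C R)).
    + exact: continuous_norm_defect.
    + move=> x /=; rewrite WE subr_ge0 ler_pXn2r ?nnegrE//.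
      by have [_ _ + _] := px x; exact.
  - apply: (clW _ [set 1] (cW _)).
      exact/accessible_closed_set1/hausdorff_accessible/norm_hausdorff.
    by move=> x /=; rewrite WE; have [_ _ _] := px x.
exists (fun y => SigSub (mem_set (WS y))) => [|x].
  apply: continuous_to_set_type; apply: continuous_ptws => a y.
  apply: (@continuous_comp (stone_cech R X) cube R[i]^o \val (W a)).
    exact: continuous_set_val.
  exact: cW.
by apply: val_inj; apply/funext => a /=; rewrite WE.
Qed.

(** * Boundary maps of the two halves of the KMS bundle *)

Lemma boundary_onto (R : realType) (A : cstarAlgType R) (X : topologicalType)
    (p : X -> state_space A) (q : X -> R) :
    continuous p -> continuous q -> (forall r, compact [set x | q x <= r]) ->
  exists chi : boundary R X ->
      \bigcap_(r in [set r : R | 0 < r]) closure (p @` [set x | r <= q x]),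
    continuous chi /\ range chi = setT.
Proof.
move=> cp cq qK; have [P cP PE] := stone_cech_extend_state cp.
apply: (image_onto cP).
rewrite (boundary_image (@hausdorff_state_space R A) cP cq qK).
by have -> : P \o @stone_cech_emb R X = p by apply/funext => x; exact: PE.
Qed.

Theorem lemma2p11 (R : realType) (S : bundle R) (A : cstarAlgType R)
    (sigma : R -> A -> A)
    (S_proper : proper_simplex_bundle S)
    (sigma_simple : simple_flow sigma)
    (S_iso : bundle_isomorphic S (kms_bundle sigma)) :
  (exists chi : boundary R (plus_part S) -> KMS_pinfty sigma,
     continuous chi /\ range chi = setT) /\
  (exists chi : boundary R (minus_part S) -> KMS_ninfty sigma,
     continuous chi /\ range chi = setT).
Proof.
have [[_ _ hS cpi _] piK _] := S_proper.
have [phi [[cphi [psi [_ psiK _]]] phipi _]] := S_iso.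
pose p (x : S) : state_space A := (\val (phi x)).1.
have cp : continuous p.
  move=> x; apply: (@continuous_comp S (state_space A * R)%type (state_space A)
    (fun x => \val (phi x)) fst).
    apply: (@continuous_comp S (kms_total sigma) (state_space A * R)%type phi \val).
      exact: cphi.
    exact: continuous_set_val.
  exact: cvg_fst.
have pKMS x : KMS sigma (bproj x) (p x).
  by have := set_valP (phi x); rewrite -(phipi x).
(* Surjectivity of the isomorphism: each fibre of S is mapped by [p] onto the KMS states at its
   inverse temperature. *)
have KMSp b w : KMS sigma b w -> exists2 x, bproj x = b & p x = w.
  move=> bw.
  have bw' : (w, b) \in kms_total sigma by rewrite inE.
  exists (psi (SigSub bw')).
    by rewrite -phipi psiK.
  by rewrite /p psiK.
have cv (B : set S) : continuous (fun x : B => p (\val x)).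
  move=> x; apply: (@continuous_comp B S _ \val p); last exact: cp.
  exact: continuous_set_val.
have cq (B : set S) : continuous (fun x : B => bproj (\val x)).
  move=> x; apply: (@continuous_comp B S R \val (@bproj R S)); last exact: cpi.
  exact: continuous_set_val.
have piI (a b : R) : compact (@bproj R S @^-1` `[a, b]%classic).
  by apply: piK; exact: segment_compact.
split.
  have -> : KMS_pinfty sigma = \bigcap_(r in [set r : R | 0 < r])
      closure ((fun x : plus_part S => p (\val x)) @`
        [set x : plus_part S | r <= bproj (\val x)]).
    apply: eq_bigcapr => r /= r0; congr closure.
    apply/seteqP; split=> [w [b /= rb /KMSp[x xb <-]]|_ [x rx <-]].
      have x0 : plus_part S x by rewrite /plus_part /= xb (le_trans (ltW r0)).
      by exists (SigSub (mem_set x0)); rewrite //= xb.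
    by exists (bproj (\val x)).
  apply: boundary_onto; [exact: cv|exact: cq|move=> r].
  apply: (@compact_set_type S (plus_part S)).
  (* Inside S_+ the sublevel set {π <= r} is the preimage of [0, r], compact by properness; it is
     empty when r < 0. *)
  rewrite (_ : _ @` _ = @bproj R S @^-1` `[0, r]%classic)//.
  apply/seteqP; split=> [_ [x xr <-] /=|x /=].
    by rewrite in_itv /= xr andbT; exact: (set_valP x).
  rewrite in_itv /= => /andP[x0 xr].
  by exists (SigSub (mem_set (x0 : plus_part S x))).
(* The negative half is treated with q = -π, so that a threshold r < 0 for β turns into the positive
   threshold -r for q. *)
have -> : KMS_ninfty sigma = \bigcap_(r in [set r : R | 0 < r])
    closure ((fun x : minus_part S => p (\val x)) @`
      [set x : minus_part S | r <= - bproj (\val x)]).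
  have E (r : R) : 0 < r ->
      \bigcup_(b in [set b : R | b <= - r]) KMS sigma b =
      (fun x : minus_part S => p (\val x)) @`
        [set x : minus_part S | r <= - bproj (\val x)].
    move=> r0; apply/seteqP; split=> [w [b /= rb /KMSp[x xb <-]]|_ [x rx <-]].
      have x0 : minus_part S x.
        by rewrite /minus_part /= xb (le_trans rb)// oppr_le0 ltW.
      by exists (SigSub (mem_set x0)); rewrite //= xb lerNr.
    by exists (bproj (\val x)); rewrite //= lerNr.
  apply/seteqP; split=> w wK r /= r0.
    by rewrite -E//; apply: wK; rewrite /= oppr_lt0.
  by rewrite -[r]opprK E ?oppr_gt0//; apply: wK; rewrite /= oppr_gt0.
apply: boundary_onto => [||r].
- exact: cv.
- move=> x; apply: (@continuous_comp (minus_part S) R R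
      (fun x => bproj (\val x)) -%R); first exact: (cq (minus_part S)).
  by apply: (@cvgN R R^o); exact: cvg_id.
- apply: (@compact_set_type S (minus_part S)).
  rewrite (_ : _ @` _ = @bproj R S @^-1` `[- r, 0]%classic)//.
  apply/seteqP; split=> [_ [x xr <-] /=|x /=].
    by rewrite in_itv /= lerNl xr; exact: (set_valP x).
  rewrite in_itv /= => /andP[xr x0].
  by exists (SigSub (mem_set (x0 : minus_part S x))); rewrite //= lerNl.
Qed.
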